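(* There exist exactly 16 values $\theta$, modulo 1, for which $D(\theta)=1+\frac{2}{\sqrt5}$. They are the classes modulo 1 of $\eta_i$ and $1-\eta_i$ for $i=1,\dots,8$, where $$\eta_1=\tfrac{13+\sqrt5}{82},\quad \eta_2=\tfrac{7-\sqrt5}{22},\quad \eta_3=\tfrac{11+\sqrt5}{58},\quad \eta_4=\tfrac{5-\sqrt5}{10},$$ $$\eta_5=\tfrac{9+\sqrt5}{38},\quad \eta_6=\tfrac{25-\sqrt5}{62},\quad \eta_7=\tfrac{3-\sqrt5}{2},\quad \eta_8=\tfrac{7+\sqrt5}{22}.$$
   Context: For $\theta\in\mathbb{R}$ and an integer $m\ge 0$, let $d_\theta(m)=\sup\{|I| : I\subset\mathbb{R}\text{ an interval},\ (I+\mathbb{Z})\cap\{0,\theta,2\theta,\dots,m\theta\}=\emptyset\}$, where $|I|$ is the length of $I$. Let $D(\theta)=\sup_{m\in\mathbb{N}}(m+1)\,d_\theta(m)$ (possibly $+\infty$), where $\mathbb{N}$ is the set of positive integers. *)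

(* Defs.v *)
From mathcomp Require Import all_boot all_order all_algebra.
From mathcomp Require Import all_classical all_reals all_analysis.

Set Implicit Arguments.
Unset Strict Implicit.
Unset Printing Implicit Defensive.

Import Order.TTheory GRing.Theory Num.Theory.
Import numFieldNormedType.Exports.

Local Open Scope classical_set_scope.
Local Open Scope ring_scope.

Definition class1 (R : realType) (x : R) : set R :=
  [set x + k%:~R | k in [set: int]].

Definition translates (R : realType) (I : set R) : set R :=
  [set x + k%:~R | x in I & k in [set: int]].

Definition multiples (R : realType) (theta : R) (m : nat) : set R :=
  [set k%:R * theta | k in [set k : nat | (k <= m)%N]].

(* Intervals are the order-convex subsets of R (of any kind, possibly empty or
   degenerate); the length of an interval is its Lebesgue measure. *)
Definition gap (R : realType) (theta : R) (m : nat) : \bar R :=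
  ereal_sup [set lebesgue_measure I | I in
    [set I : set R | is_interval I /\
                     translates I `&` multiples theta m = set0]].

Definition Dsup (R : realType) (theta : R) : \bar R :=
  ereal_sup [set (m.+1%:R%:E * gap theta m)%E | m in [set m : nat | (0 < m)%N]].

Definition etas (R : realType) : seq R :=
  let s := Num.sqrt 5 in
  [:: (13 + s) / 82; (7 - s) / 22; (11 + s) / 58; (5 - s) / 10;
      (9 + s) / 38; (25 - s) / 62; (3 - s) / 2; (7 + s) / 22].

(* Main.v *)
(** Slow continued fractions: if the N + 1 points 0, theta, ..., N theta on the
    circle have their nearest points to 0 on either side at indices ql, qr and
    distances al, br, then the largest gap seen before the next, index ql + qr,
    improves on them is al + br, so D(theta) is the supremum of
    (ql + qr - 1) (al + br) over the states (ql, qr, al, br) of the subtractive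
    Euclidean algorithm started at (1, 1, theta, 1 - theta).

    As ql br + qr al = 1, two equal moves in a row produce a value exceeding
    1 + 2 / sqrt 5 as soon as the denominators are at least 10; hence, for an
    admissible theta, the moves eventually alternate, which forces al / br to be
    the golden ratio or its inverse.  Exploring the finitely many admissible
    states with a small denominator leaves the eight eta_i below 1 / 2.
    Conversely along an alternating tail the values stay below 1 + 2 / sqrt 5
    and converge to it. *)
Require Import Defs.
From mathcomp Require Import all_boot all_order all_algebra.
From mathcomp Require Import all_classical all_reals all_analysis.
From mathcomp Require Import ring lra zify.
Set Implicit Arguments.
Unset Strict Implicit.
Unset Printing Implicit Defensive.

Import Order.TTheory GRing.Theory Num.Theory.
Import numFieldNormedType.Exports.
Local Open Scope classical_set_scope.
Local Open Scope ring_scope.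

(** * Gaps and Farey states *)

(* ql theta lies at distance al to the right of an integer, qr theta at distance
   br to the left of one. *)
Record state (R : Type) := State { ql : nat; qr : nat; al : R; br : R }.

Definition swap (R : Type) (s : state R) := State (qr s) (ql s) (br s) (al s).

Definition stepL (R : realType) (s : state R) :=
  State (ql s) (ql s + qr s) (al s) (br s - al s).

Definition stepR (R : realType) (s : state R) := swap (stepL (swap s)).

(** Both moves need a strict inequality, so the algorithm halts when [al = br]; irrationality of
    theta excludes this. *)
Inductive reach (R : realType) (s : state R) : state R -> Prop :=
| reach_refl : reach s s
| reachL t : reach s t -> al t < br t -> reach s (stepL t)
| reachR t : reach s t -> br t < al t -> reach s (stepR t).

Definition init (R : realType) (theta : R) := State 1 1 theta (1 - theta).

Definition value (R : realType) (s : state R) : R :=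
  ((ql s)%:R + (qr s)%:R - 1) * (al s + br s).

(** The last equation is the determinant condition of a Farey interval, written in distances,
    without numerators. *)
Definition valid (R : realType) (s : state R) :=
  [/\ (0 < ql s)%N, (0 < qr s)%N, 0 < al s, 0 < br s &
      (ql s)%:R * br s + (qr s)%:R * al s = 1].

Definition irrational (R : realType) (theta : R) :=
  forall (n : nat) (z : int), (0 < n)%N -> n%:R * theta <> z%:~R.

Definition approximates (R : realType) (theta : R) (s : state R) :=
  exists p p' : int, [/\ al s = (ql s)%:R * theta - p%:~R,
    br s = p'%:~R - (qr s)%:R * theta &
    (ql s)%:Z * p' - (qr s)%:Z * p = 1].

Lemma valid_swap (R : realType) (s : state R) : valid s -> valid (swap s).
Proof. by case=> *; split=> //=; rewrite addrC. Qed.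

Lemma valid_stepL (R : realType) (s : state R) :
  valid s -> al s < br s -> valid (stepL s).
Proof.
case=> hl hr ha hb e lt; split=> //=; first by lia.
  by rewrite subr_gt0.
by rewrite natrD; lra.
Qed.

Lemma valid_reach (R : realType) (s t : state R) : valid s -> reach s t -> valid t.
Proof.
move=> hs; elim=> {t} [//|t _ ht lt|t _ ht lt]; first exact: valid_stepL.
by apply/valid_swap/valid_stepL => //; apply: valid_swap.
Qed.

Lemma valid_init (R : realType) (theta : R) : 0 < theta < 1 -> valid (init theta).
Proof. by move=> h; split=> //=; lra. Qed.

Lemma value_swap (R : realType) (s : state R) : value (swap s) = value s.
Proof. by rewrite /value /=; ring. Qed.

Lemma swapK (R : Type) (s : state R) : swap (swap s) = s.
Proof. by case: s. Qed.

Lemma reach_swap (R : realType) (s t : state R) :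
  reach s t -> reach (swap s) (swap t).
Proof.
elim=> {t} [|t _ h lt|t _ h lt]; first exact: reach_refl.
  by have := reachR h; rewrite /stepR swapK; apply.
by rewrite /stepR swapK; apply: reachL.
Qed.

Lemma init_swap (R : realType) (theta : R) : swap (init theta) = init (1 - theta).
Proof. by rewrite /init /swap /=; congr State; lra. Qed.

Lemma reach_head (R : realType) (s t : state R) : reach s t ->
  [\/ t = s, al s < br s /\ reach (stepL s) t |
      br s < al s /\ reach (stepR s) t].
Proof.
elim=> {t} [|t _ IH lt|t _ IH lt]; first by constructor 1.
- case: IH => [e|[? h]|[? h]].
  + by constructor 2; rewrite -e; split=> //; apply: reach_refl.
  + by constructor 2; split=> //; apply: reachL.
  + by constructor 3; split=> //; apply: reachL.
- case: IH => [e|[? h]|[? h]].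
  + by constructor 3; rewrite -e; split=> //; apply: reach_refl.
  + by constructor 2; split=> //; apply: reachR.
  + by constructor 3; split=> //; apply: reachR.
Qed.

Lemma reach_trans (R : realType) (s t u : state R) :
  reach s t -> reach t u -> reach s u.
Proof. by move=> h; elim=> // {}u _ ? ?; [apply: reachL|apply: reachR]. Qed.

Lemma approximates_reach (R : realType) (theta : R) (t : state R) :
  reach (init theta) t -> approximates theta t.
Proof.
elim=> {t} [|t _ [p [p' [ha hb e]]] _|t _ [p [p' [ha hb e]]] _].
- by exists 0, 1; split=> /=; rewrite ?mul1r ?subr0.
- exists p, (p + p'); split=> //=; last by nia.
  by rewrite ha hb natrD intrD; ring.
- exists (p' + p), p'; split=> //=; last by nia.
  by rewrite ha hb natrD intrD; ring.
Qed.

Lemma reach_irrational_neq (R : realType) (theta : R) (t : state R) :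
  0 < theta < 1 -> irrational theta -> reach (init theta) t -> al t != br t.
Proof.
move=> h01 irr ht; apply/eqP => e.
have [hl _ _ _ _] := valid_reach (valid_init h01) ht.
have [p [p' [ha hb _]]] := approximates_reach ht.
apply: (irr (ql t + qr t)%N (p + p')); first by lia.
by rewrite natrD intrD; lra.
Qed.

Lemma gap_ge (R : realType) (theta : R) (m : nat) (a b : R) : a <= b ->
  (forall k j, (k <= m)%N -> ~ a < k%:R * theta + j%:~R < b) ->
  ((b - a)%:E <= gap theta m)%E.
Proof.
move=> ab h; apply: ereal_sup_ubound; exists `]a, b[%classic.
  split; first exact: interval_is_interval.
  rewrite -subset0 => y [] [x /= xI [j _ <-]] [k km /= e].
  apply: (h k (- j) km); rewrite e intrN addrK.
  by move: xI; rewrite in_itv.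
rewrite lebesgue_measure_itv /= lte_fin.
by case: ltgtP ab => //= -> _; rewrite subrr.
Qed.

(** All orbit points lie in [(1/n) Z], so []0, 1/n[] is free for every [m]. *)
Lemma gap_rational_ge (R : realType) (theta : R) (n : nat) (z : int) (m : nat) :
  (0 < n)%N -> n%:R * theta = z%:~R -> ((n%:R^-1)%:E <= gap theta m)%E.
Proof.
move=> n0 e; rewrite -[n%:R^-1]subr0.
have nR : 0 < n%:R :> R by rewrite ltr0n.
apply: gap_ge; first by rewrite invr_ge0 ltW.
move=> k j _ /andP[h1 h2].
have h : n%:R * (k%:R * theta + j%:~R) = (k%:Z * z + n%:Z * j)%:~R.
  by rewrite mulrDr mulrCA e intrD !intrM.
have : 0 < n%:R * (k%:R * theta + j%:~R) by rewrite mulr_gt0.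
have : n%:R * (k%:R * theta + j%:~R) < 1 by rewrite -ltr_pdivlMl // mulr1.
rewrite h ltr0z (ltrz1 R); lia.
Qed.

(** In unimodular coordinates, displacements from the left end are [a al + b br] with [a], [b]
    integers. If both are positive the point is not before the right end; if neither is, it is not
    past the left end; mixed cases push the index out of range. *)
Lemma reach_gap_ge (R : realType) (theta : R) (t : state R) : 0 < theta < 1 ->
  reach (init theta) t ->
  ((al t + br t)%:E <= gap theta (ql t + qr t).-2)%E.
Proof.
move=> h01 ht.
have [hl hr ha hb e1] := valid_reach (valid_init h01) ht.
have [p [p' [ea eb det]]] := approximates_reach ht.
(* The free interval runs from a point of index [qr - 1] to one of index [ql - 1]. *)
set x := (qr t).-1%:R * theta.
have -> : al t + br t = (x + al t + br t) - x by ring.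
apply: gap_ge; first by lra.
move=> k j km /andP[h1 h2].
pose i : int := k%:Z - (qr t).-1%:Z.
pose a := i * p' + (qr t)%:Z * j.
pose b := p * i + (ql t)%:Z * j.
have ei : i = a * (ql t)%:Z - b * (qr t)%:Z.
  rewrite /a /b; transitivity (i * ((ql t)%:Z * p' - (qr t)%:Z * p)).
    by rewrite det mulr1.
  by ring.
have ej : - j = a * p - b * p'.
  rewrite /a /b; transitivity (- j * ((ql t)%:Z * p' - (qr t)%:Z * p)).
    by rewrite det mulr1.
  by ring.
have ey : k%:R * theta + j%:~R - x = a%:~R * al t + b%:~R * br t.
  rewrite ea eb /x.
  have eiR : i%:~R = a%:~R * (ql t)%:R - b%:~R * (qr t)%:R :> R.
    by rewrite ei intrB !intrM.
  have ejR : - j%:~R = a%:~R * p%:~R - b%:~R * p'%:~R :> R.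
    by rewrite -!intrM -intrB -ej intrN.
  have eiR2 : i%:~R = k%:R - (qr t).-1%:R :> R by rewrite /i intrB.
  transitivity (i%:~R * theta - (- j%:~R)); first by rewrite eiR2; ring.
  by rewrite eiR ejR; ring.
have hi1 : i < (ql t)%:Z by rewrite /i; lia.
have hi2 : - (qr t)%:Z < i by rewrite /i; lia.
case: (lerP 1 a) => [a1|a0]; case: (lerP 1 b) => [b1|b0].
- have : 1 <= a%:~R :> R by rewrite ler1z.
  have : 1 <= b%:~R :> R by rewrite ler1z.
  by move=> *; nra.
- by nia.
- by nia.
- have : a%:~R <= 0 :> R by rewrite lerz0; lia.
  have : b%:~R <= 0 :> R by rewrite lerz0; lia.
  by move=> *; nra.
Qed.

(** Three-gap argument: adding [ql] to the index, subtracting [qr], or doing both shifts the point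
    right by [al], [br] or [al + br], and one of these keeps the index between 0 and [m]. *)
Lemma orbit_next (R : realType) (theta : R) (t : state R) (m k : nat) (j : int) :
  valid t -> approximates theta t ->
  (ql t <= m.+1)%N -> (qr t <= m.+1)%N -> (k <= m)%N ->
  exists (k' : nat) (j' : int), (k' <= m)%N /\
    k%:R * theta + j%:~R + Num.min (al t) (br t) <= k'%:R * theta + j'%:~R
      <= k%:R * theta + j%:~R + (al t + br t).
Proof.
case=> hl hr ha hb e1 [p [p' [ea eb _]]] lm rm km.
have minl : Num.min (al t) (br t) <= al t by rewrite ge_min lexx.
have minr : Num.min (al t) (br t) <= br t by rewrite ge_min lexx orbT.
case: (leqP (k + ql t) m) => [h|h].
  exists (k + ql t)%N, (j - p); split=> //.
  rewrite natrD intrB; lra.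
case: (leqP (qr t) k) => [h'|h'].
  exists (k - qr t)%N, (j + p'); split; first by lia.
  by rewrite natrB // intrD; lra.
exists (k + ql t - qr t)%N, (j - p + p'); split; first by lia.
rewrite natrB; last by lia.
by rewrite natrD intrD intrB; lra.
Qed.

(** A walk to the right from an integer below [u], with jumps at least [d > 0] and at most
    [al + br], cannot leap over [[u, v]]. *)
Lemma orbit_dense (R : realType) (theta : R) (t : state R) (m : nat) (u v : R) :
  valid t -> approximates theta t -> (ql t <= m.+1)%N -> (qr t <= m.+1)%N ->
  u + (al t + br t) <= v ->
  exists (k : nat) (j : int), (k <= m)%N /\ u <= k%:R * theta + j%:~R <= v.
Proof.
move=> hi happ lm rm uv.
set d := Num.min (al t) (br t).
have d0 : 0 < d by case: hi => _ _ ? ? _; rewrite lt_min; apply/andP.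
pose x0 : R := (Num.floor u)%:~R.
have hx0 : x0 <= u by rewrite /x0 floor_le_tmp.
have walk (n : nat) :
    (exists (k : nat) (j : int), (k <= m)%N /\ u <= k%:R * theta + j%:~R <= v) \/
    (exists (k : nat) (j : int), (k <= m)%N /\
       x0 + n%:R * d <= k%:R * theta + j%:~R <= u).
  elim: n => [|n [IH|[k [j [km /andP[h1 h2]]]]]].
  - right; exists 0%N, (Num.floor u); split=> //.
    by rewrite !mul0r addr0 add0r lexx.
  - by left.
  - have [k' [j' [km' /andP[h3 h4]]]] := @orbit_next _ _ _ _ _ j hi happ lm rm km.
    rewrite -/d in h3.
    case: (lerP u (k'%:R * theta + j'%:~R)) => h5.
      by left; exists k', j'; split=> //; lra.
    right; exists k', j'; split=> //; rewrite -natr1; lra.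
(* This many jumps of length at least [d] carry the walk past [u]. *)
have [//|[k [j [_ /andP[h1 h2]]]]] := walk (Num.truncn ((u - x0) / d)).+1.
have : (u - x0) / d < (Num.truncn ((u - x0) / d)).+1%:R by exact: truncnS_gt.
rewrite ltr_pdivrMr // => h3; lra.
Qed.

Lemma lebesgue_measure_interval_le (R : realType) (I : set R) (c : R) :
  0 <= c -> is_interval I -> (forall u v, I u -> I v -> v - u <= c) ->
  (lebesgue_measure I <= c%:E)%E.
Proof.
move=> c0 hI hc.
have [->|/set0P[u Iu]] := eqVneq I set0; first by rewrite measure0 lee_fin.
have supI : has_sup I.
  by split; [exists u | exists (u + c) => v Iv; have := hc _ _ Iu Iv; lra].
have infI : has_inf I.
  by split; [exists u | exists (u - c) => v Iv; have := hc _ _ Iv Iu; lra].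
have le : sup I - inf I <= c.
  rewrite lerBlDr; apply: sup_le_ub => [|v Iv]; first by exists u.
  rewrite -lerBlDl; apply: lb_le_inf => [|w Iw]; first by exists u.
  by have := hc _ _ Iw Iv; lra.
have infsup : inf I <= sup I.
  by apply: (@le_trans _ _ u); [apply: ge_inf => //; case: infI | apply: ub_le_sup => //; case: supI].
have sub : I `<=` `[inf I, sup I]%classic.
  move=> v Iv; rewrite /= in_itv /=; apply/andP; split.
    by apply: ge_inf => //; case: infI.
  by apply: ub_le_sup => //; case: supI.
apply: (@le_trans _ _ (lebesgue_measure `[inf I, sup I]%classic)).
  apply: le_measure => //; rewrite inE //; exact: measurable_realfun.is_interval_measurable.
rewrite lebesgue_measure_itv /= lte_fin; case: ltP => _; rewrite ?lee_fin //.
Qed.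

Lemma gap_le (R : realType) (theta : R) (t : state R) (m : nat) :
  valid t -> approximates theta t -> (ql t <= m.+1)%N -> (qr t <= m.+1)%N ->
  (gap theta m <= (al t + br t)%:E)%E.
Proof.
move=> hi happ lm rm; apply: ge_ereal_sup => _ [I [hI h0] <-].
apply: lebesgue_measure_interval_le => //; first by case: hi => _ _ ha hb _; lra.
move=> u v Iu Iv; rewrite leNgt; apply/negP => lt.
have [|k [j [km /andP[h1 h2]]]] := @orbit_dense _ _ _ _ u v hi happ lm rm; first by lra.
suff : (translates I `&` multiples theta m) (k%:R * theta) by rewrite h0.
split; last by exists k.
exists (k%:R * theta + j%:~R); first by apply: (hI u v Iu Iv); rewrite h1 h2.
by exists (- j) => //; rewrite intrN addrK.
Qed.

(** The state changes only once [ql + qr] enters the window; the three inequalities are what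
    [gap_le] and the factor [m + 1] require. *)
Lemma reach_window (R : realType) (theta : R) (n : nat) : 0 < theta < 1 ->
  (forall t, reach (init theta) t -> al t != br t) ->
  exists2 t, reach (init theta) t &
    [/\ (ql t <= n.+1)%N, (qr t <= n.+1)%N & (n.+1 < ql t + qr t)%N].
Proof.
move=> h01 neq; elim: n => [|n [t ht [h1 h2 h3]]].
  by exists (init theta) => //; apply: reach_refl.
have [hl hr _ _ _] := valid_reach (valid_init h01) ht.
case: (ltnP n.+2 (ql t + qr t)) => h4.
  by exists t => //; split => //; lia.
case: (ltgtP (al t) (br t)) (neq _ ht) => // lt _.
  by exists (stepL t); [apply: reachL | split=> /=; lia].
by exists (stepR t); [apply: reachR | split=> /=; lia].
Qed.

Lemma Dsup_le (R : realType) (theta c : R) : 0 < theta < 1 ->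
  (forall t, reach (init theta) t -> al t != br t) ->
  (forall t, reach (init theta) t -> value t <= c) -> (Dsup theta <= c%:E)%E.
Proof.
move=> h01 neq hc; apply: ge_ereal_sup => _ [m _ <-].
have [t ht [h1 h2 h3]] := reach_window m h01 neq.
have hi := valid_reach (valid_init h01) ht.
apply: (@le_trans _ _ (m.+1%:R%:E * (al t + br t)%:E)%E).
  by apply: lee_wpmul2l; [rewrite lee_fin | apply: gap_le => //; apply: approximates_reach].
rewrite -EFinM lee_fin; apply: le_trans (hc _ ht).
case: hi => _ _ ha hb _; rewrite /value ler_wpM2r //; first by lra.
by rewrite -natrD lerBrDr natr1 ler_nat.
Qed.

(** The index [m = ql + qr - 2] realises the value. [Dsup] counts only positive [m], which rules out
    the initial denominators 1 and 1. *)
Lemma value_le_Dsup (R : realType) (theta : R) (t : state R) : 0 < theta < 1 ->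
  reach (init theta) t -> (2 < ql t + qr t)%N -> ((value t)%:E <= Dsup theta)%E.
Proof.
move=> h01 ht h2.
apply: (@le_trans _ _ ((ql t + qr t).-2.+1%:R%:E * gap theta (ql t + qr t).-2)%E).
  have -> : value t = (ql t + qr t).-2.+1%:R * (al t + br t).
    rewrite /value; congr (_ * _); rewrite -natrD.
    have -> : (ql t + qr t = (ql t + qr t).-2.+2)%N by lia.
    by rewrite -[in LHS]natr1 addrK.
  rewrite EFinM; apply: lee_wpmul2l; first by rewrite lee_fin.
  exact: reach_gap_ge.
by apply: ereal_sup_ubound; exists (ql t + qr t).-2 => //=; lia.
Qed.

(** For rational theta the gaps never drop below some [1 / n], so their products with [m + 1] are
    unbounded. *)
Lemma Dsup_finite_irrational (R : realType) (theta c : R) :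
  (Dsup theta <= c%:E)%E -> irrational theta.
Proof.
move=> hD n z n0 e.
have h (m : nat) : (0 < m)%N -> m.+1%:R / n%:R <= c.
  move=> m0; rewrite -lee_fin; apply: le_trans hD.
  apply: (@le_trans _ _ (m.+1%:R%:E * gap theta m)%E).
    rewrite EFinM; apply: lee_wpmul2l; first by rewrite lee_fin.
    exact: gap_rational_ge e.
  by apply: ereal_sup_ubound; exists m.
have nR : 0 < n%:R :> R by rewrite ltr0n.
have := h (Num.truncn (c * n%:R)).+1 isT.
rewrite ler_pdivrMr // leNgt => /negP; apply.
apply: lt_trans (truncnS_gt _) _.
by rewrite ltr_nat.
Qed.

Lemma Dsup_shift (R : realType) (theta : R) (z : int) :
  Dsup (theta + z%:~R) = Dsup theta.
Proof.
have shift (x : R) (y : int) (m : nat) (I : set R) :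
    translates I `&` multiples x m = set0 ->
    translates I `&` multiples (x + y%:~R) m = set0.
  rewrite -!subset0 => h w [[v Iv [j _ <-]] [k km /= e]].
  apply: (h (k%:R * x)); split; last by exists k.
  exists v => //; exists (j - k%:Z * y) => //.
  have -> : (j - k%:Z * y)%:~R = j%:~R - k%:R * y%:~R :> R by rewrite intrB intrM.
  by rewrite addrA -e; ring.
rewrite /Dsup; congr ereal_sup; apply: eq_imagel => m _; congr (_ * _)%E.
rewrite /gap; congr ereal_sup; congr image; apply/seteqP; split=> I [hI h].
  by split=> //; rewrite -(addrK z%:~R theta) -intrN; apply: shift.
by split=> //; apply: shift.
Qed.

(** * Golden tails *)

Definition dconst (R : realType) : R := 1 + 2 / Num.sqrt 5.

Definition phi (R : realType) : R := (1 + Num.sqrt 5) / 2.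

Lemma sqrt5_sq (R : realType) : Num.sqrt 5 * Num.sqrt 5 = 5 :> R.
Proof. by rewrite -expr2 sqr_sqrtr. Qed.

(** Consecutive continued fraction convergents, tight enough for the later linear arithmetic; they
    yield the Fibonacci quotients of [phi_bounds]. *)
Lemma sqrt5_bounds (R : realType) :
  682 / 305 < (Num.sqrt 5 : R) < 161 / 72.
Proof.
have s0 : 0 <= Num.sqrt 5 :> R by apply: sqrtr_ge0.
have := sqrt5_sq R; set s := Num.sqrt 5 in s0 * => s2.
by apply/andP; split; rewrite ltNge; apply/negP => h; nra.
Qed.

Lemma dconstE (R : realType) : dconst R = 1 + 2 * Num.sqrt 5 / 5.
Proof.
have /andP[h _] := sqrt5_bounds R.
have s0 : Num.sqrt 5 != 0 :> R by rewrite gt_eqF //; lra.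
have := sqrt5_sq R; rewrite /dconst; set s := Num.sqrt 5 in s0 * => s2.
by congr (_ + _); apply: (mulIf s0); rewrite divfK //; lra.
Qed.

Lemma phi_sq (R : realType) : phi R * phi R = phi R + 1.
Proof. by have := sqrt5_sq R; rewrite /phi => h; lra. Qed.

Lemma phi_bounds (R : realType) : 987 / 610 < phi R < 233 / 144.
Proof. by have := sqrt5_bounds R; rewrite /phi => h; lra. Qed.

Definition good (R : realType) (s : state R) :=
  forall t, reach s t -> al t != br t /\ value t <= dconst R.

Lemma good_stepL (R : realType) (s : state R) :
  good s -> al s < br s -> good (stepL s).
Proof.
move=> h lt t ht; apply: h; apply: reach_trans ht.
by apply: reachL => //; apply: reach_refl.
Qed.

Lemma good_stepR (R : realType) (s : state R) :
  good s -> br s < al s -> good (stepR s).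
Proof.
move=> h lt t ht; apply: h; apply: reach_trans ht.
by apply: reachR => //; apply: reach_refl.
Qed.

Lemma good_swap (R : realType) (s : state R) : good s -> good (swap s).
Proof.
move=> h t /reach_swap; rewrite swapK => /h; rewrite value_swap /= => -[ne le].
by split=> //; rewrite eq_sym.
Qed.

Lemma good_value (R : realType) (s : state R) : good s -> value s <= dconst R.
Proof. by case/(_ _ (reach_refl s)). Qed.

Lemma good_neq (R : realType) (s : state R) : good s -> al s != br s.
Proof. by case/(_ _ (reach_refl s)). Qed.

Lemma valid_small (R : realType) (s : state R) : valid s -> (9 < ql s)%N ->
  br s < 1 / 10.
Proof.
case=> hl hr ha hb e h.
have : 10 <= (ql s)%:R :> R by rewrite (ler_nat R 10).
have : 1 <= (qr s)%:R :> R by rewrite (ler_nat R 1).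
by move=> *; nra.
Qed.

(* Two equal moves in a row give the value 2 + qr (br - 2 al) - br after the
   first of them, which exceeds 1 + 2 / sqrt 5 as soon as br < 1 / 10. *)
Lemma good_no_repeat (R : realType) (s : state R) :
  valid s -> good s -> (9 < ql s)%N -> al s < br s -> br s - al s < al s.
Proof.
move=> hi hg h lt; have hs := valid_small hi h.
have hg' := good_stepL hg lt.
case: (ltgtP (al s) (br s - al s)) (good_neq hg') => //= lt' _.
case: hi => hl hr ha hb e.
have := good_value hg'; rewrite dconstE /value /= natrD.
have := sqrt5_bounds R.
set l := (ql s)%:R in e *; set r := (qr s)%:R in e * => hs5 hv.
have r1 : 1 <= r by rewrite (ler_nat R 1).
have : 0 <= r * (br s - 2 * al s) by apply: mulr_ge0; lra.
move=> *; lra.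
Qed.

(* The defect br - phi al is multiplied by phi^2 by the moves L and R, so an
   orbit which alternates forever has defect 0. *)
Lemma good_defect_bound (R : realType) (n : nat) (s : state R) :
  valid s -> good s -> (9 < ql s)%N -> (9 < qr s)%N -> al s < br s ->
  2 ^+ n * `|br s - phi R * al s| <= 2.
Proof.
elim: n s => [|n IH] s hi hg h1 h2 lt.
  have hb := valid_small hi h1.
  have ha : al s < 1 / 10 by apply: (@valid_small _ (swap s)) => //; apply: valid_swap.
  case: hi => _ _ a0 b0 _; have := phi_bounds R; set f := phi R => hf.
  have h0 : 0 <= f * al s by apply: mulr_ge0; lra.
  have h1' : f * al s <= f * (1 / 10) by apply: ler_wpM2l; lra.
  rewrite expr0 mul1r ler_norml; lra.
have lt1 := good_no_repeat hi hg h1 lt.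
have hiL := valid_stepL hi lt; have hgL := good_stepL hg lt.
have hiR : valid (stepR (stepL s)).
  by apply: valid_swap; apply: valid_stepL => //; apply: valid_swap.
have hgR := good_stepR hgL lt1.
have lt2 : al s - (br s - al s) < br s - al s.
  have := @good_no_repeat _ (swap (stepL s)) (valid_swap hiL) (good_swap hgL).
  by apply=> //=; lia.
have := IH _ hiR hgR _ _ lt2; rewrite /= => /(_ ltac:(lia) ltac:(lia)).
have -> : br s - al s - phi R * (al s - (br s - al s)) =
    (phi R + 1) * (br s - phi R * al s).
  by have h : phi R * phi R * al s = (phi R + 1) * al s by [rewrite phi_sq]; lra.
have hf := phi_bounds R.
rewrite normrM [`|phi R + 1|]gtr0_norm; last by lra.
(* Since [phi + 1 >= 2], each pair of moves yields one factor 2. *)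
apply: le_trans; rewrite exprSr -mulrA ler_wpM2l ?exprn_ge0 //.
by rewrite ler_wpM2r //; lra.
Qed.

Lemma good_tail (R : realType) (s : state R) :
  valid s -> good s -> (9 < ql s)%N -> (9 < qr s)%N -> al s < br s ->
  br s = phi R * al s.
Proof.
move=> hi hg h1 h2 lt; apply/eqP; rewrite -subr_eq0 -normr_eq0.
case: ltgtP (normr_ge0 (br s - phi R * al s)) => // e0 _.
(* As [2 ^ n > n], this exponent contradicts the bound for a nonzero defect. *)
have := @good_defect_bound _ (Num.truncn (2 / `|br s - phi R * al s|)).+1 _ hi hg h1 h2 lt.
rewrite -ler_pdivlMr // leNgt => /negP[].
apply: lt_trans (truncnS_gt _) _.
by rewrite -natrX ltr_nat ltn_expl.
Qed.

(** The second condition controls the error term in [golden_value]: the constant 5 keeps the value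
    below [dconst] and within [5 / (ql + qr)] of it. *)
Definition golden (R : realType) (s : state R) :=
  br s = phi R * al s /\ `|(qr s)%:R * phi R - (ql s)%:R| <= 5.

Lemma golden_lt (R : realType) (s : state R) : valid s -> golden s -> al s < br s.
Proof.
by case=> _ _ ha _ _ [-> _]; have := phi_bounds R => hf; nra.
Qed.

Lemma golden_value (R : realType) (s : state R) : valid s -> golden s ->
  dconst R - 5 / ((ql s)%:R + (qr s)%:R) <= value s <= dconst R.
Proof.
move=> [hl hr ha hb e] [eb hg]; rewrite eb in e.
have e2 : dconst R - value s =
    al s * (phi R + 1 - Num.sqrt 5 / 5 * ((qr s)%:R * phi R - (ql s)%:R)).
  rewrite dconstE /value eb.
  (* Multiplying the constant by [ql br + qr al = 1] makes both sides linear in [al]. *)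
  set c := 1 + _; have -> : c = c * ((ql s)%:R * (phi R * al s) + (qr s)%:R * al s).
    by rewrite e mulr1.
  rewrite /c /phi; have := sqrt5_sq R.
  move: (Num.sqrt 5) (ql s)%:R (qr s)%:R (al s) => x l r a hx.
  have h1 : x * x * (a * l) = 5 * (a * l) by rewrite hx.
  have h2 : x * x * (a * r) = 5 * (a * r) by rewrite hx.
  lra.
have l1 : 1 <= (ql s)%:R :> R by rewrite (ler_nat R 1).
have r1 : 1 <= (qr s)%:R :> R by rewrite (ler_nat R 1).
have hs := sqrt5_bounds R; have hf := phi_bounds R.
move: hg; rewrite ler_norml; set g := (qr s)%:R * phi R - (ql s)%:R in e2 * => hg.
have h1 : 0 <= phi R + 1 - Num.sqrt 5 / 5 * g <= 5.
  have g1 : 0 <= Num.sqrt 5 * (5 - g) by apply: mulr_ge0; lra.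
  have g2 : 0 <= Num.sqrt 5 * (5 + g) by apply: mulr_ge0; lra.
  by move: hf hs; rewrite /phi => *; lra.
(* From [al (phi ql + qr) = 1] and [phi > 1]. *)
have h2 : al s <= 1 / ((ql s)%:R + (qr s)%:R).
  have h : 0 <= (ql s)%:R * (al s * (phi R - 1)).
    by rewrite !mulr_ge0 ?(ltW ha) //; lra.
  by rewrite ler_pdivlMr; lra.
have h3 : al s * (phi R + 1 - Num.sqrt 5 / 5 * g) <= 1 / ((ql s)%:R + (qr s)%:R) * 5.
  by apply: ler_pM => //; [exact: ltW | lra | lra].
have h4 : 0 <= al s * (phi R + 1 - Num.sqrt 5 / 5 * g).
  by apply: mulr_ge0; [exact: ltW | lra].
have -> : 5 / ((ql s)%:R + (qr s)%:R) = 1 / ((ql s)%:R + (qr s)%:R) * 5 :> R.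
  by rewrite mul1r mulrC.
lra.
Qed.

(** The move, followed by the swap, multiplies [qr phi - ql] by [1 - phi], the conjugate of [phi],
    whose modulus is below 1. *)
Lemma golden_stepL (R : realType) (s : state R) :
  valid s -> golden s -> golden (swap (stepL s)).
Proof.
move=> [_ _ ha hb _] [eb hg]; have hf := phi_bounds R; split=> /=.
  by rewrite eb; have h : phi R * phi R * al s = (phi R + 1) * al s by [rewrite phi_sq]; lra.
have -> : (ql s)%:R * phi R - (ql s + qr s)%:R =
    - (phi R - 1) * ((qr s)%:R * phi R - (ql s)%:R).
  have : phi R * phi R * (qr s)%:R = (phi R + 1) * (qr s)%:R by rewrite phi_sq.
  by rewrite natrD => h; lra.
rewrite normrM normrN [`|phi R - 1|]gtr0_norm; last by lra.
by have := normr_ge0 ((qr s)%:R * phi R - (ql s)%:R); move: `|_| hg => x; nra.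
Qed.

Definition semigolden (R : realType) (s : state R) := golden s \/ golden (swap s).

(** A golden state can only move left and then becomes a mirrored golden state, so the moves
    alternate. *)
Lemma semigolden_reach (R : realType) (s t : state R) :
  valid s -> semigolden s -> reach s t -> semigolden t.
Proof.
move=> hi hs ht; elim: ht => {t} [//|t ht IH lt|t ht IH lt].
- have ht' := valid_reach hi ht; case: IH => g.
    by right; apply: golden_stepL.
  by have := golden_lt (valid_swap ht') g; rewrite /= ltNge ltW.
- have ht' := valid_reach hi ht; case: IH => g.
    by have := golden_lt ht' g; rewrite /= ltNge ltW.
  left; apply: golden_stepL => //; exact: valid_swap.
Qed.

Lemma semigolden_value (R : realType) (s : state R) : valid s -> semigolden s ->
  dconst R - 5 / ((ql s)%:R + (qr s)%:R) <= value s <= dconst R.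
Proof.
move=> hi [g|g]; first exact: golden_value.
by have := golden_value (valid_swap hi) g; rewrite value_swap /= [(qr s)%:R + _]addrC.
Qed.

Lemma semigolden_neq (R : realType) (s : state R) : valid s -> semigolden s ->
  al s != br s.
Proof.
move=> hi [g|g]; first by rewrite lt_eqF // golden_lt.
by have := golden_lt (valid_swap hi) g; rewrite eq_sym => /lt_eqF /= ->.
Qed.

(** The second clause forces the supremum of the values up to [dconst]. It concerns only the tail of
    the orbit, so tightness passes back through a move. *)
Definition tight (R : realType) (s : state R) := good s /\
  forall n, exists2 t, reach s t &
    (n < ql t + qr t)%N /\ dconst R - 5 / ((ql t)%:R + (qr t)%:R) <= value t.

Lemma semigolden_tight (R : realType) (s : state R) :
  valid s -> semigolden s -> tight s.
Proof.
move=> hi hs; split=> [t ht|n].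
  have hit := valid_reach hi ht; have hst := semigolden_reach hi hs ht.
  by split; [exact: semigolden_neq | have /andP[] := semigolden_value hit hst].
suff [t ht hn] : exists2 t, reach s t & (n < ql t + qr t)%N.
  exists t => //; split=> //; have hit := valid_reach hi ht.
  by have /andP[] := semigolden_value hit (semigolden_reach hi hs ht).
elim: n => [|n [t ht hn]].
  by exists s; [exact: reach_refl | case: hi => hl _ _ _ _; lia].
have hit := valid_reach hi ht; have := semigolden_neq hit (semigolden_reach hi hs ht).
case: hit => hl hr _ _ _; case: ltgtP => // lt _.
  by exists (stepL t); [exact: reachL | rewrite /=; lia].
by exists (stepR t); [exact: reachR | rewrite /=; lia].
Qed.

Lemma tight_stepL (R : realType) (s : state R) :
  al s < br s -> value s <= dconst R -> tight (stepL s) -> tight s.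
Proof.
move=> lt hv [hg hn]; have hL : reach s (stepL s).
  by apply: reachL => //; exact: reach_refl.
split=> [t /reach_head[->|[_ /hg//]|[lt' _]]|n].
- by split=> //; rewrite lt_eqF.
- by have := lt_trans lt lt'; rewrite ltxx.
by have [t ht h] := hn n; exists t => //; exact: reach_trans ht.
Qed.

Lemma tight_swap (R : realType) (s : state R) : tight s -> tight (swap s).
Proof.
move=> [hg hn]; split=> [|n]; first exact: good_swap.
have [t ht h] := hn n; exists (swap t); first exact: reach_swap.
by rewrite value_swap /= addnC [_%:R + _]addrC.
Qed.

Lemma tight_stepR (R : realType) (s : state R) :
  br s < al s -> value s <= dconst R -> tight (stepR s) -> tight s.
Proof.
move=> lt hv /tight_swap; rewrite /stepR swapK => h.
rewrite -[s]swapK; apply: tight_swap; apply: tight_stepL => //.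
by rewrite value_swap.
Qed.

(** * The finite exploration *)

(* The state whose Farey interval is ]p / q, p' / q'[. *)
Definition farey (R : realType) (theta : R) (q p q' p' : nat) :=
  State q q' (q%:R * theta - p%:R) (p'%:R - q'%:R * theta).

(* The equation says theta = (c + phi d) / (a + phi b). *)
Lemma golden_ratio_eqn (R : realType) (theta a b c d : R) :
  c - a * theta = (1 + Num.sqrt 5) / 2 * (b * theta - d) ->
  2 * (a * a + a * b - b * b) * theta =
    2 * c * a + c * b + d * a - 2 * d * b - (b * c - a * d) * Num.sqrt 5.
Proof.
have := sqrt5_sq R; set x := Num.sqrt 5 => hx E.
(* The factor is the conjugate of [2 a + b + b sqrt 5], twice [a + phi b]; it rationalizes the
   coefficient of theta. *)
have : (c - a * theta) * (2 * a + b - b * x) =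
    (1 + x) / 2 * (b * theta - d) * (2 * a + b - b * x) by rewrite E.
have h1 : x * x * (theta * b * b) = 5 * (theta * b * b) by rewrite hx.
have h2 : x * x * (d * b) = 5 * (d * b) by rewrite hx.
move=> h; lra.
Qed.

Section Farey.
Variables (R : realType) (theta : R) (q p q' p' : nat).
Let s := farey theta q p q' p'.

Lemma farey_init : init theta = farey theta 1 0 1 1.
Proof. by rewrite /init /farey subr0 !mul1r. Qed.

Lemma farey_stepL : stepL s = farey theta q p (q + q') (p + p').
Proof. by rewrite /stepL /farey /= !natrD; congr State; ring. Qed.

Lemma farey_stepR : stepR s = farey theta (q + q') (p + p') q' p'.
Proof.
rewrite /stepR /farey /swap /stepL /= !natrD addnC; congr State; ring.
Qed.

(** With numerals as endpoints this is affine in theta, hence accessible to [lra]. *)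
Lemma farey_value : value s =
  (q%:R + q'%:R - 1) * (p'%:R - p%:R + (q%:R - q'%:R) * theta).
Proof. by rewrite /value /=; ring. Qed.

(* 341 / 180 = 1 + 2 / 5 * (161 / 72). *)
Lemma good_farey_bound : good s -> (q%:R + q'%:R - 1) *
  (p'%:R - p%:R + (q%:R - q'%:R) * theta) <= 341 / 180.
Proof.
move/good_value; rewrite farey_value dconstE => /le_trans; apply.
have := sqrt5_bounds R; lra.
Qed.

(** Comparing [al] with [br] amounts to comparing theta with the mediant; [good] excludes
    equality. *)
Lemma good_farey_cases : good s ->
  ((q + q')%:R * theta < (p + p')%:R /\
    good (farey theta q p (q + q') (p + p'))) \/
  ((p + p')%:R < (q + q')%:R * theta /\
    good (farey theta (q + q') (p + p') q' p')).
Proof.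
move=> hg; case: (ltgtP (al s) (br s)) (good_neq hg) => // lt _.
- left; rewrite -farey_stepL; split; last exact: good_stepL.
  by move: lt; rewrite /= !natrD; lra.
- right; rewrite -farey_stepR; split; last exact: good_stepR.
  by move: lt; rewrite /= !natrD; lra.
Qed.

Lemma farey_valid : (0 < q)%N -> (0 < q')%N -> (q * p' == q' * p + 1)%N ->
  p%:R < q%:R * theta -> q'%:R * theta < p'%:R -> valid s.
Proof.
move=> h1 h2 /eqP e h3 h4; split=> //=; rewrite ?subr_gt0 //.
transitivity ((q * p')%:R - (q' * p)%:R : R); first by rewrite !natrM; ring.
by rewrite e natrD addrC addKr.
Qed.

(* Eliminating phi: rationalizing theta = (p' + phi p) / (q' + phi q), and its
   mirror image, with q p' - q' p = 1. *)
Lemma good_farey_tail : good s -> (9 < q)%N -> (9 < q')%N ->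
  (q * p' == q' * p + 1)%N -> p%:R < q%:R * theta -> q'%:R * theta < p'%:R ->
  2 * (q'%:R * q'%:R + q%:R * q'%:R - q%:R * q%:R) * theta =
    2 * p'%:R * q'%:R + p'%:R * q%:R + p%:R * q'%:R - 2 * p%:R * q%:R
      - Num.sqrt 5 \/
  2 * (q%:R * q%:R + q%:R * q'%:R - q'%:R * q'%:R) * theta =
    2 * p%:R * q%:R + p'%:R * q%:R + p%:R * q'%:R - 2 * p'%:R * q'%:R
      + Num.sqrt 5.
Proof.
move=> hg h1 h2 e h3 h4.
have hi : valid s by apply: farey_valid => //; lia.
have det : q%:R * p'%:R - q'%:R * p%:R = 1 :> R.
  by rewrite -!natrM (eqP e) natrD addrC addKr.
have s5 := sqrt5_sq R.
case: (ltgtP (al s) (br s)) (good_neq hg) => // lt _.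
- have := good_tail hi hg h1 h2 lt; rewrite /= /phi => E.
  by left; have := golden_ratio_eqn E; rewrite det => h; lra.
- have := good_tail (valid_swap hi) (good_swap hg) h2 h1 lt; rewrite /= /phi => E.
  right.
  (* Negating all four entries brings the mirrored relation into the form of [golden_ratio_eqn]. *)
  have {}E : - p%:R - - q%:R * theta =
      (1 + Num.sqrt 5) / 2 * (- q'%:R * theta - - p'%:R) by lra.
  have := golden_ratio_eqn E.
  have -> : - q'%:R * - p%:R - - q%:R * - p'%:R = - 1 :> R by lra.
  by move=> h; lra.
Qed.

Lemma tight_farey_stepL : (q + q')%:R * theta < (p + p')%:R ->
  (q%:R + q'%:R - 1) * (p'%:R - p%:R + (q%:R - q'%:R) * theta)
    <= 1 + 2 * Num.sqrt 5 / 5 ->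
  tight (farey theta q p (q + q') (p + p')) -> tight s.
Proof.
rewrite -farey_stepL -farey_value -dconstE !natrD => lt hv.
by apply: tight_stepL => //=; lra.
Qed.

Lemma tight_farey_stepR : (p + p')%:R < (q + q')%:R * theta ->
  (q%:R + q'%:R - 1) * (p'%:R - p%:R + (q%:R - q'%:R) * theta)
    <= 1 + 2 * Num.sqrt 5 / 5 ->
  tight (farey theta (q + q') (p + p') q' p') -> tight s.
Proof.
rewrite -farey_stepR -farey_value -dconstE !natrD => lt hv.
by apply: tight_stepR => //=; lra.
Qed.

(** The conditions of [golden] are doubled to clear the denominator of [phi], so the bound 5 becomes
    10. *)
Lemma tight_farey_goldenL : (0 < q)%N -> (0 < q')%N ->
  (q * p' == q' * p + 1)%N ->
  p%:R < q%:R * theta -> q'%:R * theta < p'%:R ->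
  2 * (p'%:R - q'%:R * theta) = (1 + Num.sqrt 5 : R) * (q%:R * theta - p%:R) ->
  - 10 <= q'%:R * (1 + Num.sqrt 5 : R) - 2 * q%:R <= 10 -> tight s.
Proof.
move=> h1 h2 e h3 h4 h5 h6; apply: semigolden_tight; first exact: farey_valid.
by left; rewrite /golden /= /phi ler_norml; split; lra.
Qed.

Lemma tight_farey_goldenR : (0 < q)%N -> (0 < q')%N ->
  (q * p' == q' * p + 1)%N ->
  p%:R < q%:R * theta -> q'%:R * theta < p'%:R ->
  2 * (q%:R * theta - p%:R) = (1 + Num.sqrt 5 : R) * (p'%:R - q'%:R * theta) ->
  - 10 <= q%:R * (1 + Num.sqrt 5 : R) - 2 * q'%:R <= 10 -> tight s.
Proof.
move=> h1 h2 e h3 h4 h5 h6; apply: semigolden_tight; first exact: farey_valid.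
by right; rewrite /golden /= /phi ler_norml; split; lra.
Qed.

End Farey.

(** For branches where the value bound contradicts the Farey interval around theta. *)
Ltac dead := let H := fresh "H" in let V := fresh "V" in
  move=> H *; have V := good_farey_bound H; clear H; exfalso; lra.

(** The bound from an inner node stays in context to help refute deeper branches. *)
Ltac keep_bound := let H := fresh "H" in let V := fresh "V" in
  move=> H; have V := good_farey_bound H; move: H.

Ltac mediant := let H := fresh "H" in let Lo := fresh "Lo" in let Hi := fresh "Hi" in
  move=> H Lo Hi; case: (good_farey_cases H) => -[];
  [clear Hi | clear Lo]; clear H; rewrite /addn /=;
  [move=> Hi H; move: H Lo Hi | move=> Lo H; move: H Lo Hi].

(** Both denominators exceed 9 at such a leaf, so the tail equation leaves two candidates; each is
    refuted by the bounds or found in the list. *)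
Ltac eta :=
  let H := fresh "H" in let Lo := fresh "Lo" in let Hi := fresh "Hi" in
  let V := fresh "V" in let E := fresh "E" in let B := fresh "B" in
  move=> H Lo Hi; have V := good_farey_bound H;
  match type of H with good (R := ?R) _ => have B := sqrt5_bounds R end;
  case: (good_farey_tail H isT isT isT Lo Hi) => E; clear H;
  first [exfalso; lra
        | clear - E; rewrite /etas !inE;
          repeat first [by apply/eqP; lra
                       | apply/orP; first [by left; apply/eqP; lra | right]]].

Lemma good_etas (R : realType) (theta : R) : 0 < theta < 1 / 2 ->
  good (init theta) -> theta \in etas R.
Proof.
move=> /andP[h0 h1] H.
have : good (farey theta 1 0 2 1).
  rewrite -[farey _ _ _ _ _]/(farey theta 1 0 (1 + 1) (0 + 1)) -farey_stepL.
  by rewrite -farey_init; apply: good_stepL => //=; lra.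
have : 0%:R < 1%:R * theta by rewrite mul1r.
have : 2%:R * theta < 1%:R by lra.
clear h0 h1 H => Hi Lo H; move: H Lo Hi.
(* The branch below the mediant always comes first, so the eight [eta] leaves give the values in
   increasing order. *)
mediant.
- keep_bound; mediant.
  - mediant.
    - mediant; [dead | ].
      keep_bound; mediant; [dead | ].
      mediant.
      - eta.
      - mediant; dead.
    - mediant.
      - keep_bound; mediant.
        - mediant; dead.
        - keep_bound; mediant; [ | dead].
          eta.
      - keep_bound; mediant.
        - keep_bound; mediant; [dead | ].
          eta.
        - mediant; dead.
  - mediant.
    - keep_bound; mediant.
      - mediant; dead.
      - keep_bound; mediant.
        - eta.
        - mediant; dead.
    - keep_bound; mediant.
      - keep_bound; mediant.
        - mediant; dead.
        - eta.
      - mediant; dead.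
- mediant.
  - keep_bound; mediant.
    - mediant; [dead | ].
      keep_bound; mediant; [ | dead].
      eta.
    - keep_bound; mediant.
      - keep_bound; mediant; [dead | ].
        eta.
      - mediant; dead.
  - keep_bound; mediant.
    - keep_bound; mediant.
      - mediant; dead.
      - keep_bound; mediant; [ | dead].
        eta.
    - mediant; [ | dead].
      keep_bound; mediant.
      - mediant; dead.
      - mediant; dead.
Qed.

(** * The sixteen classes *)

Ltac left_move := apply: tight_farey_stepL; [lra | lra | rewrite /addn /=].
Ltac right_move := apply: tight_farey_stepR; [lra | lra | rewrite /addn /=].

Lemma etas_tight (R : realType) (theta : R) : theta \in etas R ->
  0 < theta < 1 / 2 /\ tight (init theta).
Proof.
have B := sqrt5_bounds R; have s5 := sqrt5_sq R.
rewrite farey_init /etas !inE.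
case/or4P => [/eqP E|/eqP E|/eqP E|/or4P[/eqP E|/eqP E|/eqP E|/orP[]/eqP E]];
  (split; first by lra).
(* Each path follows the algorithm to a state with distances in golden ratio, the larger being [br]
   for [goldenL] and [al] for [goldenR]. *)
- do 4 left_move; right_move.
  by apply: tight_farey_goldenR => //; rewrite ?E; lra.
- do 3 left_move; right_move.
  by apply: tight_farey_goldenL => //; rewrite ?E; lra.
- do 3 left_move; right_move.
  by apply: tight_farey_goldenR => //; rewrite ?E; lra.
- do 2 left_move; right_move.
  by apply: tight_farey_goldenL => //; rewrite ?E; lra.
- do 2 left_move; right_move.
  by apply: tight_farey_goldenR => //; rewrite ?E; lra.
- left_move; right_move; do 2 left_move.
  by apply: tight_farey_goldenR => //; rewrite ?E; lra.
- left_move; right_move.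
  by apply: tight_farey_goldenL => //; rewrite ?E; lra.
- left_move; right_move.
  by apply: tight_farey_goldenR => //; rewrite ?E; lra.
Qed.

Lemma tight_Dsup (R : realType) (theta : R) : 0 < theta < 1 ->
  tight (init theta) -> Dsup theta = (dconst R)%:E.
Proof.
move=> h01 [hg hn]; apply/eqP; rewrite eq_le; apply/andP; split.
  by apply: Dsup_le => // t /hg[].
apply/lee_addgt0Pr => e e0.
(* The offset 2 also secures [2 < ql + qr], needed by [value_le_Dsup]. *)
have [t ht [lt hv]] := hn (Num.truncn (5 / e)).+2.
have := @value_le_Dsup _ _ _ h01 ht ltac:(lia).
have h : 5 / ((ql t)%:R + (qr t)%:R) <= e.
  rewrite -natrD ler_pdivrMr ?ltr0n ?(leq_trans _ lt) // -ler_pdivrMl //.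
  rewrite mulrC; apply: ltW; apply: lt_le_trans (truncnS_gt _) _.
  by rewrite ler_nat; apply: leq_trans lt; rewrite ltnS leqW.
move=> hD; rewrite -leeBlDr //; apply: le_trans hD.
by rewrite -EFinB lee_fin; lra.
Qed.

Lemma Dsup_good (R : realType) (theta : R) : 0 < theta < 1 ->
  Dsup theta = (dconst R)%:E -> good (init theta).
Proof.
move=> h01 hD.
have irr : irrational theta by apply: (@Dsup_finite_irrational _ _ (dconst R)); rewrite hD.
move=> t ht; split; first exact: (reach_irrational_neq h01 irr).
case: (ltnP 2 (ql t + qr t)) => h.
  by have := value_le_Dsup h01 ht h; rewrite hD lee_fin.
(* Denominators 1 and 1 remain; they do not count in [Dsup], but the value there is 1. *)
have [hl hr _ _ e] := valid_reach (valid_init h01) ht.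
have [el er] : ql t = 1%N /\ qr t = 1%N by lia.
rewrite dconstE /value; rewrite el er in e *.
by have := sqrt5_bounds R; lra.
Qed.

(** Replacing theta by [1 - theta] swaps the states, which reduces to theta below 1/2; at 1/2 the
    algorithm halts at once. *)
Lemma Dsup_eq_etas (R : realType) (theta : R) : 0 < theta < 1 ->
  Dsup theta = (dconst R)%:E <-> theta \in etas R \/ 1 - theta \in etas R.
Proof.
move=> h01; split=> [hD|[/etas_tight[_ ht]|/etas_tight[_ ht]]].
- have hg := Dsup_good h01 hD.
  case: (ltgtP theta (1 / 2)) => h12.
  + by left; apply: good_etas => //; lra.
  + by right; apply: good_etas; [lra | rewrite -init_swap; apply: good_swap].
  + by have := good_neq hg; rewrite /= h12 => /eqP[]; lra.
- exact: tight_Dsup.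
- apply: tight_Dsup => //; have := tight_swap ht.
  by rewrite init_swap; congr (tight (init _)); lra.
Qed.

Lemma class1_shift (R : realType) (x : R) (k : int) :
  class1 (x + k%:~R) = class1 x.
Proof.
apply/seteqP; split=> z [j _ <-].
  by exists (k + j) => //; rewrite intrD addrA.
by exists (j - k) => //; rewrite intrB; lra.
Qed.

Lemma class1_inj (R : realType) (x y : R) : 0 < x < 1 -> 0 < y < 1 ->
  class1 x = class1 y -> x = y.
Proof.
move=> hx hy h; have : class1 x x by exists 0 => //; rewrite addr0.
rewrite h => -[k _ e].
have : (-1)%:~R < (k%:~R : R) < 1 by rewrite intrN; lra.
rewrite ltr_int (ltrz1 R) => hk.
have k0 : k = 0 by lia.
by rewrite -e k0 mulr0z addr0.
Qed.

(** Reversing the reflected half makes the list increasing, so distinctness follows from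
    sortedness. *)
Definition etas16 (R : realType) : seq R :=
  etas R ++ rev [seq 1 - x | x <- etas R].

Lemma etas16_uniq (R : realType) : uniq (etas16 R).
Proof.
apply: lt_sorted_uniq; have B := sqrt5_bounds R.
by rewrite /etas16 /etas /rev /= ; do ?[apply/andP; split]; lra.
Qed.

Lemma mem_etas16 (R : realType) (x : R) :
  (x \in etas16 R) = (x \in etas R) || (1 - x \in etas R).
Proof.
rewrite mem_cat mem_rev; congr orb; apply/mapP/idP => [[y hy ->]|h].
  by rewrite subKr.
by exists (1 - x) => //; rewrite subKr.
Qed.

Lemma etas16_01 (R : realType) (x : R) : x \in etas16 R -> 0 < x < 1.
Proof. by rewrite mem_etas16 => /orP[] /etas_tight[] h _; lra. Qed.

Lemma Dsup_dconstP (R : realType) (theta : R) : Dsup theta = (dconst R)%:E <->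
  exists2 x, x \in etas16 R & class1 x theta.
Proof.
split=> [hD|[x hx [k _ <-]]]; last first.
  rewrite Dsup_shift; apply/(Dsup_eq_etas (etas16_01 hx)).
  by apply/orP; rewrite -mem_etas16.
pose x := theta - (Num.floor theta)%:~R.
have ex : theta = x + (Num.floor theta)%:~R by rewrite subrK.
exists x; last by exists (Num.floor theta).
have irr : irrational theta.
  by apply: (@Dsup_finite_irrational _ _ (dconst R)); rewrite hD.
have x01 : 0 < x < 1.
  have /andP[h1 h2] := floor_itv theta; rewrite intrD in h2.
  (* Irrationality keeps the fractional part away from 0. *)
  have := irr 1%N (Num.floor theta) isT; rewrite mul1r => /eqP ne.
  rewrite /x subr_gt0 lt_neqAle eq_sym ne h1 /=; lra.
rewrite mem_etas16; apply/orP; apply/(Dsup_eq_etas x01).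
by rewrite -hD ex Dsup_shift.
Qed.

Theorem mainTheorem2 (R : realType) :
  let S : set R := [set theta | Dsup theta = (1 + 2 / Num.sqrt 5)%:E] in
  ([set class1 theta | theta in S] #= `I_16)%card /\
  S = \bigcup_(eta in [set` etas R]) (class1 eta `|` class1 (1 - eta)).
Proof.
move=> S; split.
  have -> : [set class1 theta | theta in S] = [set class1 x | x in [set` etas16 R]].
    apply/seteqP; split=> [_ [theta /Dsup_dconstP[x hx [k _ <-]] <-]|_ [x hx <-]].
      by exists x => //; rewrite class1_shift.
    exists x => //; apply/Dsup_dconstP; exists x => //.
    by exists 0 => //; rewrite addr0.
  (* Indexing by position reduces the cardinality to injectivity on [I_16]. *)
  have -> : [set class1 x | x in [set` etas16 R]] =
      [set class1 (nth 0 (etas16 R) i) | i in `I_16].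
    apply/seteqP; split=> [_ [x /= hx <-]|_ [i hi <-]].
      by exists (index x (etas16 R)); [rewrite /= -index_mem in hx * | rewrite nth_index].
    by exists (nth 0 (etas16 R) i) => //; apply: mem_nth.
  apply: inj_card_eq => i j; rewrite !inE /= => hi hj h.
  apply/eqP; rewrite -(nth_uniq 0 _ _ (etas16_uniq R)) //; apply/eqP.
  by apply: class1_inj h; apply: etas16_01; apply: mem_nth.
apply/seteqP; split=> theta.
  move=> /Dsup_dconstP[x]; rewrite mem_etas16 => /orP[] hx hc.
    by exists x => //; left.
  by exists (1 - x) => //; right; rewrite subKr.
move=> [eta /= he [] hc]; apply/Dsup_dconstP.
  by exists eta => //; rewrite mem_etas16 he.
by exists (1 - eta) => //; rewrite mem_etas16 subKr he orbT.
Qed.
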